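(* Let $k$ be the number of equivalence classes of three-dimensional subspaces generating a four-dimensional real Lie algebra $\mathfrak{g}$. 1. If $\mathfrak{g}=\mathfrak{g}_{3,4}^{\alpha}\oplus\mathfrak{g}_1$, $0\le\alpha\ne1$, then $k=3$ for $\alpha=0$ and $k=4$ for $\alpha\ne0$. 2. If $\mathfrak{g}=\mathfrak{g}_{4,2}^{\alpha}$, $\alpha\ne0$, then $k=1$ for $\alpha=1$ and $k=3$ in other cases. 3. If $\mathfrak{g}=\mathfrak{g}_{4,5}^{\alpha,\beta}$, where $-1<\alpha\le\beta\le1$, $\alpha\beta\ne0$, or $\alpha=-1$, $0<\beta\le1$, and $(\alpha,\beta)\ne(1,1)$, then $k=1$ for $\alpha=\beta\neq 1$ or $\beta=1$, $\alpha\ne1$, and $k=4$ in other cases. 4. If $\mathfrak{g}=\mathfrak{g}_{4,8}^{\alpha}$, $-1\le\alpha\le1$, then $k=1$ for $\alpha=1$ and $k=2$ for $\alpha\ne1$.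
   Context: A subspace of $\mathfrak{g}$ generates $\mathfrak{g}$ if the smallest Lie subalgebra containing it is $\mathfrak{g}$. Two subspaces are equivalent if one is the image of the other under an automorphism of the Lie algebra $\mathfrak{g}$. The Lie algebras have a basis $E_1,E_2,E_3,E_4$ with the following nonzero commutators (up to antisymmetry): $\mathfrak{g}_{3,4}^{\alpha}\oplus\mathfrak{g}_1$: $[E_2,E_3]=E_1-\alpha E_2$, $[E_3,E_1]=\alpha E_1-E_2$. $\mathfrak{g}_{4,2}^{\alpha}$: $[E_1,E_4]=\alpha E_1$, $[E_2,E_4]=E_2$, $[E_3,E_4]=E_2+E_3$. $\mathfrak{g}_{4,5}^{\alpha,\beta}$: $[E_1,E_4]=E_1$, $[E_2,E_4]=\beta E_2$, $[E_3,E_4]=\alpha E_3$. $\mathfrak{g}_{4,8}^{\alpha}$: $[E_1,E_4]=(1+\alpha)E_1$, $[E_2,E_4]=E_2$, $[E_3,E_4]=\alpha E_3$, $[E_2,E_3]=E_1$. *)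

(* Defs.v *)
From HB Require Import structures.
From mathcomp Require Import all_boot all_order all_algebra.
From mathcomp Require Import all_classical reals.

Set Implicit Arguments.
Unset Strict Implicit.
Unset Printing Implicit Defensive.

Import Order.TTheory GRing.Theory Num.Theory.
Local Open Scope classical_set_scope.
Local Open Scope card_scope.
Local Open Scope ring_scope.

(* Lie algebras here are finite-dimensional, so that subspaces of [g] are     *)
(* elements of [{vspace g}].                                                  *)
HB.mixin Record isLieAlgebra (K : fieldType) V of Vector K V := {
  lie : V -> V -> V;
  lie_linearl : forall y, linear (lie ^~ y);
  lie_linearr : forall x, linear (lie x);
  liexx : forall x, lie x x = 0;
  lie_jacobi : forall x y z,
    lie x (lie y z) + lie y (lie z x) + lie z (lie x y) = 0
}.

#[short(type="lieAlgType")]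
HB.structure Definition LieAlgebra (K : fieldType) :=
  {V of isLieAlgebra K V & Vector K V}.

Definition lie_subalgebra (K : fieldType) (g : lieAlgType K) (U : {vspace g}) :=
  forall x y, x \in U -> y \in U -> lie x y \in U.

Definition smallest_subalgebra (K : fieldType) (g : lieAlgType K)
    (V W : {vspace g}) :=
  [/\ lie_subalgebra W, (V <= W)%VS &
      forall U : {vspace g}, lie_subalgebra U -> (V <= U)%VS -> (W <= U)%VS].

Definition generates (K : fieldType) (g : lieAlgType K) (V : {vspace g}) :=
  smallest_subalgebra V fullv.

Definition lie_automorphism (K : fieldType) (g : lieAlgType K) (f : 'End(g)) :=
  bijective f /\ forall x y, f (lie x y) = lie (f x) (f y).

Definition equivalent (K : fieldType) (g : lieAlgType K) (U V : {vspace g}) :=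
  exists2 f : 'End(g), lie_automorphism f & V = (f @: U)%VS.

Definition generating3 (K : fieldType) (g : lieAlgType K) (V : {vspace g}) :=
  (\dim V = 3)%N /\ generates V.

Definition generating3_classes (K : fieldType) (g : lieAlgType K)
    : set (set {vspace g}) :=
  [set [set U | generating3 U /\ equivalent V U] | V in
     [set V : {vspace g} | generating3 V]].

Definition number_of_classes_is (K : fieldType) (g : lieAlgType K) (k : nat) : Prop :=
  @generating3_classes K g #= `I_k.

(* A Lie algebra is one of the algebras below when it has a basis with the    *)
(* given commutators.                                                         *)
Definition is_g34_g1 (K : fieldType) (alpha : K) (g : lieAlgType K) :=
  exists E1 E2 E3 E4 : g, basis_of fullv [:: E1; E2; E3; E4] /\
    [/\ lie E2 E3 = E1 - alpha *: E2, lie E3 E1 = alpha *: E1 - E2,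
        lie E1 E2 = 0 & [/\ lie E1 E4 = 0, lie E2 E4 = 0 & lie E3 E4 = 0]].

Definition is_g42 (K : fieldType) (alpha : K) (g : lieAlgType K) :=
  exists E1 E2 E3 E4 : g, basis_of fullv [:: E1; E2; E3; E4] /\
    [/\ lie E1 E4 = alpha *: E1, lie E2 E4 = E2, lie E3 E4 = E2 + E3 &
        [/\ lie E1 E2 = 0, lie E1 E3 = 0 & lie E2 E3 = 0]].

Definition is_g45 (K : fieldType) (alpha beta : K) (g : lieAlgType K) :=
  exists E1 E2 E3 E4 : g, basis_of fullv [:: E1; E2; E3; E4] /\
    [/\ lie E1 E4 = E1, lie E2 E4 = beta *: E2, lie E3 E4 = alpha *: E3 &
        [/\ lie E1 E2 = 0, lie E1 E3 = 0 & lie E2 E3 = 0]].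

Definition is_g48 (K : fieldType) (alpha : K) (g : lieAlgType K) :=
  exists E1 E2 E3 E4 : g, basis_of fullv [:: E1; E2; E3; E4] /\
    [/\ lie E1 E4 = (1 + alpha) *: E1, lie E2 E4 = E2,
        lie E3 E4 = alpha *: E3, lie E2 E3 = E1 &
        lie E1 E2 = 0 /\ lie E1 E3 = 0].

(* Main.v *)
(* A three-dimensional subspace V of a four-dimensional Lie algebra g either   *)
(* is a subalgebra or generates g, and V is the kernel of a linear form, unique *)
(* up to scaling. Each algebra of the list has a basis e1, .., e4 in which      *)
(* -ad e4 acts on <e1, e2, e3> by a diagonal matrix or a Jordan block plus an   *)
(* eigenvalue, and <e1, e2, e3> is abelian or a Heisenberg algebra. The         *)
(* subalgebra condition on V is then explicit in the values of the form on this *)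
(* basis, and explicit automorphisms bring the form to one of a few normal      *)
(* forms. The normal forms are told apart by the one-dimensional ideals         *)
(* contained in V: automorphisms permute the one-dimensional ideals of g, and   *)
(* the weights of ad e4 on them are multiplied by a common scalar.              *)

Require Import Defs.
From HB Require Import structures.
From mathcomp Require Import all_boot all_order all_algebra.
From mathcomp Require Import all_classical reals.
From mathcomp Require Import ring lra.

Set Implicit Arguments.
Unset Strict Implicit.
Unset Printing Implicit Defensive.

Import Order.TTheory GRing.Theory Num.Theory.
Local Open Scope ring_scope.

(** A hyperplane that is not a subalgebra already generates ([generating3P]), so the problem is to
    classify, up to automorphism and scaling, the forms [phi] whose kernel is not closed under the
    bracket. An automorphism amounts to a second basis satisfying the same relations
    ([frame_equivalent]), so each normalisation is a choice of such a basis.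

    Let D be the map x -> [x, e4] on the ideal <e1, e2, e3>. When this ideal is abelian, the kernel
    of [phi] is a subalgebra as soon as [phi] restricts to an eigenvector of the transpose of D
    ([eigenform_subalgebra]). If D is diagonal with distinct eigenvalues, rescaling the eigenvectors
    and translating e4 leaves only the support of the restriction, which must have at least two
    elements: four normal forms ([diag_cover]). An automorphism permutes the eigenlines and
    multiplies the spectrum by a scalar, which is 1 unless the spectrum is {d, -d, 0}
    ([scale_permutes_spectrum]); in that exceptional case a swap merges two of the four forms
    ([diag_three_classes]). An eigenplane brings so many automorphisms that one class remains
    ([diag_one_class]). A Jordan block gives three classes, or one if its eigenvalue equals the
    remaining eigenvalue.

    When <e1, e2, e3> is a Heisenberg algebra, all forms with [phi e1] nonzero are equivalent. The
    others factor through the quotient by e1, where D has eigenvalues 1 and [alpha], and they yield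
    a second class exactly when these differ. The line of e1 is the only one-dimensional ideal,
    which separates the two classes. *)

(** * Brackets, equivalence of subspaces, and hyperplanes as kernels of forms *)

Section LieGeneral.
Variables (K : fieldType) (g : lieAlgType K).
Implicit Types (x y z : g) (U V W : {vspace g}) (f : 'End(g)).

Lemma lieDl x y z : lie (x + y) z = lie x z + lie y z.
Proof. by have := lie_linearl z 1 x y; rewrite !scale1r. Qed.

Lemma lieDr x y z : lie x (y + z) = lie x y + lie x z.
Proof. by have := lie_linearr x 1 y z; rewrite !scale1r. Qed.

Lemma lie0l x : lie 0 x = 0.
Proof. by apply: (addrI (lie 0 x)); rewrite -lieDl !addr0. Qed.

Lemma lie0r x : lie x 0 = 0.
Proof. by apply: (addrI (lie x 0)); rewrite -lieDr !addr0. Qed.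

Lemma lieZl (a : K) x y : lie (a *: x) y = a *: lie x y.
Proof. by have := lie_linearl y a x 0; rewrite !addr0 lie0l addr0. Qed.

Lemma lieZr (a : K) x y : lie x (a *: y) = a *: lie x y.
Proof. by have := lie_linearr x a y 0; rewrite !addr0 lie0r addr0. Qed.

Lemma lieC x y : lie x y = - lie y x.
Proof.
have := liexx (x + y); rewrite lieDl !lieDr !liexx add0r addr0.
by move/eqP; rewrite addr_eq0 => /eqP.
Qed.

Lemma lieNl x y : lie (- x) y = - lie x y.
Proof. by rewrite -scaleN1r lieZl scaleN1r. Qed.

Lemma lieNr x y : lie x (- y) = - lie x y.
Proof. by rewrite -scaleN1r lieZr scaleN1r. Qed.

Lemma automorphismVE f : lie_automorphism f ->
  lie_automorphism f^-1%VF /\ lker f = 0%VS.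
Proof.
case=> bij_f f_lie; have kf : lker f == 0%VS by apply/lker0P/bij_inj.
split; last exact/eqP.
split; first by exists f; [exact: lker0_lfunVK | exact: lker0_lfunK].
move=> x y; apply: (bij_inj bij_f).
by rewrite f_lie !lker0_lfunVK.
Qed.

Lemma equivalent_refl V : equivalent V V.
Proof.
exists \1%VF; last by rewrite lim1g.
split; last by move=> x y; rewrite !id_lfunE.
by exists id => x; rewrite id_lfunE.
Qed.

Lemma equivalent_sym U V : equivalent U V -> equivalent V U.
Proof.
case=> f /automorphismVE[autV kf] ->; exists f^-1%VF => //.
by rewrite -limg_comp lker0_compVf ?lim1g // kf.
Qed.

Lemma equivalent_trans U V W :
  equivalent U V -> equivalent V W -> equivalent U W.
Proof.
case=> f [bf f_lie] -> [h [bh h_lie] ->]; exists (h \o f)%VF.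
  split; last by move=> x y; rewrite !comp_lfunE f_lie h_lie.
  by apply: (eq_bij (bij_comp bh bf)) => x /=; rewrite comp_lfunE.
by rewrite limg_comp.
Qed.

(** Counting principle: sending an index to the class of its representative is a bijection onto the
    classes. Inequivalence is asked only for [i < j], so an invariant that moves in one direction
    suffices. *)
Lemma number_of_classes_reps (s : seq {vspace g}) :
  {in s, forall V, generating3 V} ->
  (forall i j, (i < j)%N -> (j < size s)%N ->
     ~ equivalent (nth 0%VS s i) (nth 0%VS s j)) ->
  (forall V, generating3 V -> exists2 U, U \in s & equivalent V U) ->
  number_of_classes_is g (size s).
Proof.
move=> gen_s neq_s cov_s.
pose cls V : set {vspace g} := [set U | generating3 U /\ equivalent V U]%classic.
have eq_cls U V : equivalent U V -> cls U = cls V.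
  move=> eUV; apply/seteqP; split=> W [gW eW]; split=> //.
    exact: equivalent_trans (equivalent_sym eUV) eW.
  exact: equivalent_trans eUV eW.
rewrite /number_of_classes_is.
have -> : @generating3_classes K g =
    ((fun i => cls (nth 0%VS s i)) @` `I_(size s))%classic.
  apply/seteqP; split=> [C [V /= gV <-] | C [i /= lti <-]].
    have [U Us eVU] := cov_s V gV.
    exists (index U s); first by rewrite /= index_mem.
    by rewrite /= nth_index //; apply/esym/eq_cls.
  by exists (nth 0%VS s i) => //=; apply/gen_s/mem_nth.
apply: inj_card_eq => i j; rewrite !inE /= => lti ltj eq_ij.
have : equivalent (nth 0%VS s i) (nth 0%VS s j).
  have : cls (nth 0%VS s j) (nth 0%VS s j).
    by split; [apply/gen_s/mem_nth | apply: equivalent_refl].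
  by rewrite /= -eq_ij => -[].
case: (ltngtP i j) => // ltij e.
  by case: (neq_s i j).
by case: (neq_s j i) => //; apply: equivalent_sym.
Qed.

(** A subalgebra strictly containing a hyperplane has full dimension. *)
Lemma generating3P V : \dim {:g} = 4%N ->
  generating3 V <-> \dim V = 3%N /\ ~ lie_subalgebra V.
Proof.
move=> dimg; split=> [[dV [_ _ minV]] | [dV nsubV]].
  split=> // subV; have /dimvS := minV _ subV (subvv V).
  by rewrite dimg dV.
split=> //; split; [by move=> *; apply: memvf | exact: subvf |].
move=> U subU VU; have [eqVU|neqVU] := eqVneq V U; first by case: nsubV; rewrite eqVU.
have ltVU : (\dim V < \dim U)%N.
  rewrite ltn_neqAle dimvS // andbT.
  by apply: contra neqVU; rewrite (dimv_leqif_eq VU).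
have eqUf : U == fullv.
  by rewrite -(dimv_leqif_eq (subvf U)) eqn_leq dimvS ?subvf //= dimg -dV.
by rewrite (eqP eqUf).
Qed.

Implicit Types phi psi : 'Hom(g, K^o).

Lemma dim_lker phi : phi != 0 -> ((\dim (lker phi)).+1 = \dim {:g})%N.
Proof.
move=> phi0; rewrite -(limg_ker_dim phi fullv) capfv -addn1; congr (_ + _)%N.
apply/esym/eqP; rewrite eqn_leq; apply/andP; split.
  by have := dimvS (subvf (limg phi)); rewrite dimvf.
rewrite lt0n dimv_eq0; apply: contraNneq phi0 => lim0.
by apply/eqP/lfunP => x; apply/eqP; rewrite zero_lfunE -memv0 -lim0 memv_img ?memvf.
Qed.

(** Any [w] outside [V] spans a complement; the form is the coordinate along [w] in this
    decomposition. *)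
Lemma codim1_lker V : ((\dim V).+1 = \dim {:g})%N ->
  exists2 phi : 'Hom(g, K^o), phi != 0 & V = lker phi.
Proof.
move=> dV.
have [w wV] : exists w, w \notin V.
  have : ~~ (fullv <= V)%VS by apply/negP => /dimvS; rewrite -dV ltnn.
  by case/subvPn => w _ wV; exists w.
have w0 : w != 0 by apply: contraNneq wV => ->; rewrite mem0v.
have dw : (<[w]> :&: V = 0)%VS.
  apply/eqP; rewrite -subv0; apply/subvP => x; rewrite memv_cap => /andP[/vlineP[k ->]].
  have [->|k0] := eqVneq k 0; first by rewrite scale0r !mem0v.
  by rewrite rpredZeq (negPf k0) (negPf wV).
have fw : (<[w]> + V)%VS = fullv.
  apply/eqP; rewrite -(dimv_leqif_eq (subvf _)) dimv_disjoint_sum //.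
  by rewrite dim_vline w0 add1n dV.
have [c0 c0P] := linear_of_free (rT := K^o) [:: w] [:: 1].
pose c : 'Hom(g, K^o) := linfun c0.
have fr : free [:: w] by rewrite seq1_free.
have cw : c w = 1 by rewrite lfunE; case: (c0P fr erefl).
exists (c \o daddv_pi <[w]> V)%VF.
  apply/lfunPn; exists w; rewrite comp_lfunE daddv_pi_id ?memv_line //.
  by rewrite zero_lfunE cw oner_eq0.
apply/vspaceP => x; rewrite memv_ker comp_lfunE.
have xwV : x \in (<[w]> + V)%VS by rewrite fw memvf.
have xE := daddv_pi_add dw xwV.
have /vlineP[k kE] := memv_pi <[w]> V x.
have ck : c (daddv_pi <[w]> V x) = k by rewrite kE linearZ /= cw [LHS]mulr1.
by rewrite ck -{1}xE kE rpredDr ?memv_pi // rpredZeq (negPf wV) orbF.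
Qed.

Lemma formD phi x y : phi (x + y) = phi x + phi y :> K.
Proof. exact: (linearD phi). Qed.

Lemma formN phi x : phi (- x) = - phi x :> K.
Proof. exact: (linearN phi). Qed.

Lemma formZ phi a x : phi (a *: x) = a * phi x :> K.
Proof. exact: (linearZZ phi). Qed.

Lemma form0 phi : phi 0 = 0 :> K.
Proof. exact: (linear0 phi). Qed.

(* One family for all four types: [s] is the off-diagonal Jordan entry of the
   action of [e4], and [h] makes the first three vectors span a Heisenberg
   algebra when it is nonzero. *)
Definition is_frame (p q r s h : K) (e1 e2 e3 e4 : g) :=
  basis_of fullv [:: e1; e2; e3; e4] /\
  [/\ lie e1 e4 = p *: e1, lie e2 e4 = q *: e2, lie e3 e4 = s *: e2 + r *: e3,
      lie e2 e3 = h *: e1 & lie e1 e2 = 0 /\ lie e1 e3 = 0].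

End LieGeneral.

(** * Coordinates in a basis of four vectors *)

Definition comb4 (K : fieldType) (V : lmodType K) (e1 e2 e3 e4 : V)
    (x1 x2 x3 x4 : K) :=
  x1 *: e1 + x2 *: e2 + x3 *: e3 + x4 *: e4.

Lemma comb4E (K : fieldType) (V W : lmodType K) (f : {linear V -> W})
    e1 e2 e3 e4 x1 x2 x3 x4 :
  f (comb4 e1 e2 e3 e4 x1 x2 x3 x4) =
  comb4 (f e1) (f e2) (f e3) (f e4) x1 x2 x3 x4.
Proof. by rewrite /comb4 !linearD !linearZ. Qed.

Section Frame.
Variables (K : fieldType) (g : lieAlgType K) (e1 e2 e3 e4 : g).
Hypothesis e_basis : basis_of fullv [:: e1; e2; e3; e4].
Local Notation vec := (comb4 e1 e2 e3 e4).

Lemma vecP x : exists x1 x2 x3 x4, x = vec x1 x2 x3 x4.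
Proof.
have : x \in <<[:: e1; e2; e3; e4]>>%VS by rewrite (span_basis e_basis) memvf.
move/coord_span => ->.
rewrite !big_ord_recl big_ord0 /= addr0 !addrA.
by do 4!eexists.
Qed.

Lemma basis_hom (W : vectType K) (w1 w2 w3 w4 : W) :
  exists f : 'Hom(g, W), [/\ f e1 = w1, f e2 = w2, f e3 = w3 & f e4 = w4].
Proof.
have [f fP] := linear_of_free [:: e1; e2; e3; e4] [:: w1; w2; w3; w4].
have [] := fP (basis_free e_basis) erefl.
by exists (linfun f); rewrite !lfunE.
Qed.

Lemma form_vec (phi : 'Hom(g, K^o)) x1 x2 x3 x4 :
  phi (vec x1 x2 x3 x4) =
  x1 * phi e1 + x2 * phi e2 + x3 * phi e3 + x4 * phi e4 :> K.
Proof. by rewrite /comb4 !formD !formZ. Qed.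

Lemma eq_form_coords x1 x2 x3 x4 y1 y2 y3 y4 :
  (forall phi : 'Hom(g, K^o),
     phi (vec x1 x2 x3 x4) = phi (vec y1 y2 y3 y4) :> K) ->
  [/\ x1 = y1, x2 = y2, x3 = y3 & x4 = y4].
Proof.
move=> E.
have P (a1 a2 a3 a4 : K) : x1 * a1 + x2 * a2 + x3 * a3 + x4 * a4 =
    y1 * a1 + y2 * a2 + y3 * a3 + y4 * a4.
  have [f [f1 f2 f3 f4]] := @basis_hom K^o a1 a2 a3 a4.
  by have := E f; rewrite !form_vec f1 f2 f3 f4.
split.
- by have := P 1 0 0 0; rewrite !mulr0 !addr0 !mulr1.
- by have := P 0 1 0 0; rewrite !mulr0 !addr0 !add0r !mulr1.
- by have := P 0 0 1 0; rewrite !mulr0 !addr0 !add0r !mulr1.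
- by have := P 0 0 0 1; rewrite !mulr0 !add0r !mulr1.
Qed.

Lemma vec_inj x1 x2 x3 x4 y1 y2 y3 y4 :
  vec x1 x2 x3 x4 = vec y1 y2 y3 y4 -> [/\ x1 = y1, x2 = y2, x3 = y3 & x4 = y4].
Proof. by move=> E; apply: eq_form_coords => phi; rewrite E. Qed.

(** Linear forms separate points; this turns vector identities into scalar ones, within reach of
    [ring]. *)
Lemma eq_formP (x y : g) :
  (forall phi : 'Hom(g, K^o), phi x = phi y :> K) -> x = y.
Proof.
have [x1 [x2 [x3 [x4 ->]]]] := vecP x.
have [y1 [y2 [y3 [y4 ->]]]] := vecP y => E.
by have [-> -> -> ->] := eq_form_coords E.
Qed.

Lemma vec0 : vec 0 0 0 0 = 0.
Proof. by rewrite /comb4 !scale0r !addr0. Qed.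

Lemma vecZ k x1 x2 x3 x4 :
  k *: vec x1 x2 x3 x4 = vec (k * x1) (k * x2) (k * x3) (k * x4).
Proof. by rewrite /comb4 !scalerDr !scalerA. Qed.

Lemma vecD x1 x2 x3 x4 y1 y2 y3 y4 :
  vec x1 x2 x3 x4 + vec y1 y2 y3 y4 = vec (x1 + y1) (x2 + y2) (x3 + y3) (x4 + y4).
Proof. by apply: eq_formP => phi; rewrite formD !form_vec; ring. Qed.

Lemma vecZE1 u : u *: e1 = vec u 0 0 0.
Proof. by rewrite /comb4 !scale0r !addr0. Qed.

Lemma vecZE2 u : u *: e2 = vec 0 u 0 0.
Proof. by rewrite /comb4 !scale0r !addr0 add0r. Qed.

Lemma vecZE3 u : u *: e3 = vec 0 0 u 0.
Proof. by rewrite /comb4 !scale0r !addr0 !add0r. Qed.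

Lemma vecE1 : e1 = vec 1 0 0 0.
Proof. by rewrite /comb4 !scale0r scale1r !addr0. Qed.

Lemma vecE2 : e2 = vec 0 1 0 0.
Proof. by rewrite /comb4 !scale0r scale1r !addr0 add0r. Qed.

Lemma vecE3 : e3 = vec 0 0 1 0.
Proof. by rewrite /comb4 !scale0r scale1r !addr0 !add0r. Qed.

Lemma vecE4 : e4 = vec 0 0 0 1.
Proof. by rewrite /comb4 !scale0r scale1r !add0r. Qed.

Lemma dim_frame : \dim {:g} = 4%N.
Proof. by case/andP: e_basis => /eqP <- /eqP. Qed.

End Frame.

Lemma basis4 (K : fieldType) (V : vectType K) (v1 v2 v3 v4 : V) :
  \dim {:V} = 4%N ->
  (forall k1 k2 k3 k4, comb4 v1 v2 v3 v4 k1 k2 k3 k4 = 0 ->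
     [/\ k1 = 0, k2 = 0, k3 = 0 & k4 = 0]) ->
  basis_of fullv [:: v1; v2; v3; v4].
Proof.
move=> dimV indep; rewrite basisEfree subvf dimV andbT.
apply/(@freeP _ _ 4 [tuple v1; v2; v3; v4]) => k.
rewrite !big_ord_recl big_ord0 /= addr0 !addrA => /indep[k1 k2 k3 k4] i.
case: i => [[|[|[|[|//]]]] lti].
- by rewrite -[RHS]k1; congr k; apply/val_inj.
- by rewrite -[RHS]k2; congr k; apply/val_inj.
- by rewrite -[RHS]k3; congr k; apply/val_inj.
- by rewrite -[RHS]k4; congr k; apply/val_inj.
Qed.

(** * Frames, automorphisms and generating hyperplanes *)

Section FrameBracket.
Variables (K : fieldType) (g : lieAlgType K) (p q r s h : K) (e1 e2 e3 e4 : g).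
Hypothesis fr_e : is_frame p q r s h e1 e2 e3 e4.
Local Notation vec := (comb4 e1 e2 e3 e4).

Lemma lie_vec x1 x2 x3 x4 y1 y2 y3 y4 :
  lie (vec x1 x2 x3 x4) (vec y1 y2 y3 y4) =
  vec (p * (x1 * y4 - x4 * y1) + h * (x2 * y3 - x3 * y2))
    (q * (x2 * y4 - x4 * y2) + s * (x3 * y4 - x4 * y3))
    (r * (x3 * y4 - x4 * y3)) 0.
Proof.
case: fr_e => e_basis [l14 l24 l34 l23 [l12 l13]].
apply: (eq_formP e_basis) => phi.
rewrite /comb4 !(lieDl, lieDr, lieZl, lieZr) !liexx.
rewrite [lie e2 e1]lieC [lie e3 e1]lieC [lie e3 e2]lieC.
rewrite [lie e4 e1]lieC [lie e4 e2]lieC [lie e4 e3]lieC.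
rewrite l12 l13 l14 l23 l24 l34 !(formD, formZ, formN, form0).
ring.
Qed.

Lemma is_frame_vec x1 x2 x3 x4 y1 y2 y3 y4 z1 z2 z3 z4 t1 t2 t3 t4
    (v1 := vec x1 x2 x3 x4) (v2 := vec y1 y2 y3 y4)
    (v3 := vec z1 z2 z3 z4) (v4 := vec t1 t2 t3 t4) :
  (forall k1 k2 k3 k4 : K,
     k1 * x1 + k2 * y1 + k3 * z1 + k4 * t1 = 0 ->
     k1 * x2 + k2 * y2 + k3 * z2 + k4 * t2 = 0 ->
     k1 * x3 + k2 * y3 + k3 * z3 + k4 * t3 = 0 ->
     k1 * x4 + k2 * y4 + k3 * z4 + k4 * t4 = 0 ->
     [/\ k1 = 0, k2 = 0, k3 = 0 & k4 = 0]) ->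
  [/\ lie v1 v4 = p *: v1, lie v2 v4 = q *: v2, lie v3 v4 = s *: v2 + r *: v3,
      lie v2 v3 = h *: v1 & lie v1 v2 = 0 /\ lie v1 v3 = 0] ->
  is_frame p q r s h v1 v2 v3 v4.
Proof.
move=> indep brackets; split=> //; have e_basis := fr_e.1.
apply: basis4; first exact: dim_frame e_basis.
move=> k1 k2 k3 k4; rewrite {1}/comb4 !vecZ !vecD // -(vec0 e1 e2 e3 e4).
by case/(vec_inj e_basis); apply: indep.
Qed.

End FrameBracket.

Section FrameForms.
Variables (K : fieldType) (g : lieAlgType K) (p q r s h : K) (e1 e2 e3 e4 : g).
Hypothesis fr_e : is_frame p q r s h e1 e2 e3 e4.
Local Notation vec := (comb4 e1 e2 e3 e4).

(** The linear map taking each [e] to the corresponding [v] preserves brackets, since both bases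
    have the same structure constants, and it pulls [psi] back to [phi]. *)
Lemma frame_equivalent v1 v2 v3 v4 (phi psi : 'Hom(g, K^o)) :
  is_frame p q r s h v1 v2 v3 v4 ->
  psi v1 = phi e1 -> psi v2 = phi e2 -> psi v3 = phi e3 -> psi v4 = phi e4 ->
  equivalent (lker phi) (lker psi).
Proof.
move=> fr_v E1 E2 E3 E4.
have [f [f1 f2 f3 f4]] := basis_hom fr_e.1 v1 v2 v3 v4.
have [f' [f'1 f'2 f'3 f'4]] := basis_hom fr_v.1 e1 e2 e3 e4.
have fK x : f' (f x) = x.
  have [x1 [x2 [x3 [x4 ->]]]] := vecP fr_e.1 x.
  by rewrite !comb4E /= f1 f2 f3 f4 f'1 f'2 f'3 f'4.
have f'K x : f (f' x) = x.
  have [x1 [x2 [x3 [x4 ->]]]] := vecP fr_v.1 x.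
  by rewrite !comb4E /= f'1 f'2 f'3 f'4 f1 f2 f3 f4.
have psif x : psi (f x) = phi x.
  have [x1 [x2 [x3 [x4 ->]]]] := vecP fr_e.1 x.
  by rewrite !comb4E /= f1 f2 f3 f4 E1 E2 E3 E4.
exists f.
  split; first by exists f'.
  move=> x y; have [x1 [x2 [x3 [x4 ->]]]] := vecP fr_e.1 x.
  have [y1 [y2 [y3 [y4 ->]]]] := vecP fr_e.1 y.
  by rewrite (lie_vec fr_e) !comb4E /= f1 f2 f3 f4 (lie_vec fr_v).
apply/vspaceP => y; rewrite memv_ker; apply/eqP/memv_imgP => [y0 | [x + ->]].
  by exists (f' y); rewrite ?f'K // memv_ker -psif f'K y0.
by rewrite memv_ker psif => /eqP.
Qed.

Lemma generating3_lker (phi : 'Hom(g, K^o)) x y :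
  phi x = 0 -> phi y = 0 -> phi (lie x y) <> 0 -> generating3 (lker phi).
Proof.
move=> phix phiy phixy; have dimg := dim_frame fr_e.1.
apply/(generating3P _ dimg); split.
  apply/eqP; rewrite -eqSS dim_lker ?dimg //.
  by apply: contra_notN phixy => /eqP ->; rewrite zero_lfunE.
by move=> /(_ x y); rewrite !memv_ker phix phiy eqxx => /(_ isT isT)/eqP.
Qed.

Lemma generating3_form V : generating3 V ->
  exists2 phi : 'Hom(g, K^o), V = lker phi &
    ~ (forall x y, phi x = 0 -> phi y = 0 -> phi (lie x y) = 0).
Proof.
have dimg := dim_frame fr_e.1; move=> /(generating3P _ dimg)[dV nsub].
have [|phi _ VE] := @codim1_lker _ _ V; first by rewrite dV dimg.
exists phi => // sub; apply: nsub => x y; rewrite VE !memv_ker.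
by move=> /eqP/sub{}sub /eqP/sub ->.
Qed.

End FrameForms.

(** * One-dimensional ideals *)

Section Ideals.
Variables (K : fieldType) (g : lieAlgType K).
Implicit Types (x : g) (f : 'End(g)).

Definition spans_ideal x := x != 0 /\ forall y, exists k, lie x y = k *: x.

Lemma spans_ideal_aut f x :
  lie_automorphism f -> spans_ideal x -> spans_ideal (f x).
Proof.
case=> bij_f f_lie [x0 xI]; split.
  by apply: contra_neq x0 => fx0; apply: (bij_inj bij_f); rewrite fx0 linear0.
move=> y; case: bij_f => f' fK f'K; have [k kE] := xI (f' y).
by exists k; rewrite -(f'K y) -f_lie kE linearZ.
Qed.

End Ideals.

(** * Subalgebra criterion when <e1, e2, e3> is abelian *)

Section AlmostAbelian.
Variables (K : fieldType) (g : lieAlgType K) (p q r s : K) (e1 e2 e3 e4 : g).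
Hypothesis fr_e : is_frame p q r s 0 e1 e2 e3 e4.

(** The hypotheses say that [phi] composed with D is [l] times [phi] on the ideal. As [x, y] = y4
    D(x') - x4 D(y'), where primes denote components in the ideal, [phi] of the bracket is l (y4
    phi(x) - x4 phi(y)): the terms in [phi e4] cancel. *)
Lemma eigenform_subalgebra (phi : 'Hom(g, K^o)) (l : K) :
  p * phi e1 = l * phi e1 -> q * phi e2 = l * phi e2 ->
  r * phi e3 = l * phi e3 - s * phi e2 ->
  forall x y, phi x = 0 -> phi y = 0 -> phi (lie x y) = 0.
Proof.
move=> E1 E2 E3 x y.
have [x1 [x2 [x3 [x4 ->]]]] := vecP fr_e.1 x.
have [y1 [y2 [y3 [y4 ->]]]] := vecP fr_e.1 y.
rewrite (lie_vec fr_e) !form_vec => X Y.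
transitivity (l * (y4 * (x1 * phi e1 + x2 * phi e2 + x3 * phi e3 + x4 * phi e4)
  - x4 * (y1 * phi e1 + y2 * phi e2 + y3 * phi e3 + y4 * phi e4)) : K).
  ring: E1 E2 E3.
by rewrite X Y !mulr0 subr0 mulr0.
Qed.

End AlmostAbelian.

(* The last three hypotheses on the [d]s exclude [c = -1], which forces the
   spectrum to be [{d, -d, 0}]. *)
Lemma scale_permutes_spectrum (R : realFieldType) (c d1 d2 d3 : R) :
  d1 <> d2 -> d1 <> d3 -> d2 <> d3 ->
  (d1 = - d2 -> d3 <> 0) -> (d1 = - d3 -> d2 <> 0) -> (d2 = - d3 -> d1 <> 0) ->
  [\/ d1 = c * d1, d1 = c * d2 | d1 = c * d3] ->
  [\/ d2 = c * d1, d2 = c * d2 | d2 = c * d3] ->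
  [\/ d3 = c * d1, d3 = c * d2 | d3 = c * d3] -> c = 1.
Proof.
move=> n12 n13 n23 s12 s13 s23.
(* A transposition forces [c] to be 1 or -1, and -1 requires the fixed eigenvalue to vanish. *)
have sw (a b e : R) : a <> b -> (a = - b -> e <> 0) ->
    a = c * b -> b = c * a -> e = c * e -> c = 1.
  move=> nab sab ab ba ee.
  have [//|c1] := eqVneq c 1.
  have e0 : e = 0.
    have : (c - 1) * e = 0 by rewrite mulrBl -ee mul1r subrr.
    by move/eqP; rewrite mulf_eq0 subr_eq0 (negPf c1) => /eqP.
  have /eqP : (c + 1) * (a - b) = 0 by rewrite mulrDl mulrBr -ab -ba; ring.
  rewrite mulf_eq0 subr_eq0 => /orP[|/eqP//]; rewrite addr_eq0 => /eqP cN1.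
  by case: sab; rewrite // ab cN1 mulN1r.
(* A three-cycle gives [c ^+ 3 = 1], and [c ^+ 2 + c + 1] is positive in an ordered field. *)
have cyc (a b e : R) : a <> b -> a = c * b -> b = c * e -> e = c * a -> c = 1.
  move=> nab ab be ea; have [//|c1] := eqVneq c 1.
  have : (c - 1) * ((c ^+ 2 + c + 1) * a) = 0.
    rewrite mulrA (_ : _ * a = c * (c * (c * a)) - a); last by ring.
    by rewrite -ea -be -ab subrr.
  move/eqP; rewrite !mulf_eq0 subr_eq0 (negPf c1) /=.
  have /gt_eqF -> : 0 < c ^+ 2 + c + 1 by nra.
  move=> /eqP a0; case: nab; rewrite a0 be ea a0 !mulr0 //.
have [//|c1] := eqVneq c 1.
have fixed (e : R) : e = c * e -> e = 0.
  move=> ee; have /eqP : (c - 1) * e = 0 by rewrite mulrBl -ee mul1r subrr.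
  by rewrite mulf_eq0 subr_eq0 (negPf c1) => /eqP.
case=> [A|A|A] [B|B|B] [C|C|C];
  try (by [case: n12; rewrite A [RHS]B | case: n13; rewrite A [RHS]C
          | case: n23; rewrite B [RHS]C]).
- by case: n12; rewrite (fixed _ A) (fixed _ B).
- exact: sw n23 s23 B C A.
- exact: sw n12 s12 A B C.
- exact: cyc n12 A B C.
- exact: cyc n13 A C B.
- exact: sw n13 s13 A C B.
Qed.

(** * Diagonal action: normalisation of forms, ideals and automorphisms *)

Section Diagonal.
Variables (R : realFieldType) (g : lieAlgType R) (d1 d2 d3 : R) (e1 e2 e3 e4 : g).
Hypothesis fr_e : is_frame d1 d2 d3 0 0 e1 e2 e3 e4.
Local Notation vec := (comb4 e1 e2 e3 e4).

Lemma diag_frame s1 s2 s3 t1 t2 t3 : s1 <> 0 -> s2 <> 0 -> s3 <> 0 ->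
  is_frame d1 d2 d3 0 0 (vec s1 0 0 0) (vec 0 s2 0 0) (vec 0 0 s3 0)
    (vec t1 t2 t3 1).
Proof.
move=> /eqP s1n /eqP s2n /eqP s3n; apply: (is_frame_vec fr_e) => [k1 k2 k3 k4|].
  rewrite !mulr0 !addr0 !add0r mulr1 => + + + k40; rewrite k40 !mul0r !addr0.
  move=> /eqP; rewrite mulf_eq0 (negPf s1n) orbF => /eqP ->.
  move=> /eqP; rewrite mulf_eq0 (negPf s2n) orbF => /eqP ->.
  by move=> /eqP; rewrite mulf_eq0 (negPf s3n) orbF => /eqP ->.
rewrite !(lie_vec fr_e) !vecZ !(vecD fr_e.1) -(vec0 e1 e2 e3 e4).
by split; [| | | |split]; congr comb4; ring.
Qed.

(** Rescaling the eigenvectors makes every nonzero value 1. Translating e4 along an eigenvector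
    where the form is nonzero absorbs [phi e4], hence the last hypothesis. *)
Lemma diag_equivalent (phi psi : 'Hom(g, R^o)) :
  psi e1 = (phi e1 != 0)%:R :> R -> psi e2 = (phi e2 != 0)%:R :> R ->
  psi e3 = (phi e3 != 0)%:R :> R -> psi e4 = 0 :> R ->
  [|| phi e1 != 0, phi e2 != 0 | phi e3 != 0] ->
  equivalent (lker phi) (lker psi).
Proof.
(* Where the form vanishes the scaling factor is 1, as it has to stay invertible. *)
have sc (a : R) : exists2 s : R, s <> 0 & s * (a != 0)%:R = a.
  have [->|/eqP a0] := eqVneq a 0; last by exists a; rewrite ?mulr1.
  by exists 1; rewrite ?mulr0 //; apply/eqP/oner_neq0.
move=> E1 E2 E3 E4 n0.
have [s1 s1n s1E] := sc (phi e1); have [s2 s2n s2E] := sc (phi e2).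
have [s3 s3n s3E] := sc (phi e3).
have [t1 [t2 [t3 tE]]] : exists t1 t2 t3 : R, t1 * (phi e1 != 0)%:R +
   t2 * (phi e2 != 0)%:R + t3 * (phi e3 != 0)%:R = phi e4.
  case/or3P: n0 => ->;
    [exists (phi e4), 0, 0|exists 0, (phi e4), 0|exists 0, 0, (phi e4)];
  by rewrite !mul0r mulr1 ?addr0 ?add0r.
apply: (frame_equivalent fr_e (diag_frame t1 t2 t3 s1n s2n s3n));
  by rewrite form_vec E1 E2 E3 E4 !(mul0r, mulr0, addr0, add0r) //.
Qed.

Lemma lie_e_e4 : [/\ lie e1 e4 = d1 *: e1, lie e2 e4 = d2 *: e2 & lie e3 e4 = d3 *: e3].
Proof. by case: fr_e => _ [-> -> -> _ _]; rewrite scale0r add0r. Qed.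

Hypotheses (n12 : d1 <> d2) (n13 : d1 <> d3) (n23 : d2 <> d3).

Lemma diag_spans_ideal_e : [/\ spans_ideal e1, spans_ideal e2 & spans_ideal e3].
Proof.
have I (d : R) e : e != 0 ->
    (forall y1 y2 y3 y4, lie e (vec y1 y2 y3 y4) = (y4 * d) *: e) ->
    spans_ideal e.
  move=> e0 eE; split=> // y; have [y1 [y2 [y3 [y4 ->]]]] := vecP fr_e.1 y.
  by exists (y4 * d).
have e_neq0 x1 x2 x3 x4 : [|| x1 != 0, x2 != 0 | x3 != 0] -> vec x1 x2 x3 x4 != 0.
  apply: contraTneq; rewrite -(vec0 e1 e2 e3 e4) => /(vec_inj fr_e.1)[-> -> -> _].
  by rewrite eqxx.
split; [apply: (I d1) | apply: (I d2) | apply: (I d3)].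
- by rewrite (vecE1 e1 e2 e3 e4) e_neq0 ?oner_eq0.
- move=> y1 y2 y3 y4; rewrite {1 3}(vecE1 e1 e2 e3 e4) (lie_vec fr_e) vecZ.
  by congr comb4; ring.
- by rewrite (vecE2 e1 e2 e3 e4) e_neq0 ?oner_eq0 ?orbT.
- move=> y1 y2 y3 y4; rewrite {1 3}(vecE2 e1 e2 e3 e4) (lie_vec fr_e) vecZ.
  by congr comb4; ring.
- by rewrite (vecE3 e1 e2 e3 e4) e_neq0 ?oner_eq0 ?orbT.
- move=> y1 y2 y3 y4; rewrite {1 3}(vecE3 e1 e2 e3 e4) (lie_vec fr_e) vecZ.
  by congr comb4; ring.
Qed.

Lemma diag_spans_ideal x : spans_ideal x ->
  exists2 u : R, u != 0 & [\/ x = u *: e1, x = u *: e2 | x = u *: e3].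
Proof.
have [x1 [x2 [x3 [x4 ->]]]] := vecP fr_e.1 x; case=> x0 xI.
have x40 : x4 = 0.
  (* Brackets have no e4 component, so if [x4] were nonzero the factor [k] would be 0 and [x] would
     commute with everything; commuting with [e1] and [e2] gives [d1 = d2 = 0]. *)
  apply/eqP; apply: contra_notT n12 => x4n.
  have dz (y : g) (d y1 y2 y3 : R) :
    lie (vec x1 x2 x3 x4) y = vec y1 y2 y3 0 -> lie (vec x1 x2 x3 x4) y = 0.
    have [k ->] := xI y; rewrite vecZ => /(vec_inj fr_e.1)[_ _ _ /eqP].
    rewrite mulf_eq0 (negPf x4n) orbF => /eqP ->.
    by rewrite !mul0r vec0.
  have z1 : lie (vec x1 x2 x3 x4) (vec 1 0 0 0) = 0.
    by apply: dz; [exact: d1 | exact: lie_vec fr_e _ _ _ _ _ _ _ _].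
  have z2 : lie (vec x1 x2 x3 x4) (vec 0 1 0 0) = 0.
    by apply: dz; [exact: d1 | exact: lie_vec fr_e _ _ _ _ _ _ _ _].
  move: z1 z2; rewrite !(lie_vec fr_e) -(vec0 e1 e2 e3 e4).
  move=> /(vec_inj fr_e.1)[/eqP + _ _ _] /(vec_inj fr_e.1)[_ /eqP + _ _].
  rewrite !(mulr0, mul0r, mulr1, addr0, subr0, sub0r, mulrN, oppr_eq0, mulf_eq0).
  by rewrite (negPf x4n) !orbF => /eqP -> /eqP ->.
have [k] := xI (vec 0 0 0 1).
rewrite (lie_vec fr_e) vecZ x40 !(mulr0, mul0r, mulr1, addr0, subr0) => E.
have [E1 E2 E3 _] := vec_inj fr_e.1 E.
have eigen (d y : R) : d * y = k * y -> y != 0 -> d = k.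
  by move=> dy y0; apply: (mulIf y0).
move: x0; rewrite x40.
have [x10|x1n] := eqVneq x1 0; have [x20|x2n] := eqVneq x2 0;
  have [x30|x3n] := eqVneq x3 0;
  try by [case: n12; rewrite (eigen _ _ E1) ?(eigen _ _ E2)
         |case: n13; rewrite (eigen _ _ E1) ?(eigen _ _ E3)
         |case: n23; rewrite (eigen _ _ E2) ?(eigen _ _ E3)].
- by rewrite x10 x20 x30 vec0 eqxx.
- move=> _; exists x3 => //; apply: Or33.
  by rewrite x10 x20 /comb4 !scale0r !add0r addr0.
- move=> _; exists x2 => //; apply: Or32.
  by rewrite x10 x30 /comb4 !scale0r !add0r !addr0.
- move=> _; exists x1 => //; apply: Or31.
  by rewrite x20 x30 /comb4 !scale0r !addr0.
Qed.

Definition maps_to_line (f : 'End(g)) (c d : R) (e : g) :=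
  exists2 u : R, u != 0 &
    [\/ f e = u *: e1 /\ d = c * d1, f e = u *: e2 /\ d = c * d2
      | f e = u *: e3 /\ d = c * d3].

(** The common scalar [c] is the e4-coordinate of [f e4]: bracketing an eigenvector with [f e4]
    multiplies it by [c] times its weight. *)
Lemma diag_aut f : lie_automorphism f ->
  exists c, [/\ maps_to_line f c d1 e1, maps_to_line f c d2 e2 &
                maps_to_line f c d3 e3].
Proof.
move=> autf; have [y1 [y2 [y3 [y4 yE]]]] := vecP fr_e.1 (f e4).
have line (d : R) e : spans_ideal e -> lie e e4 = d *: e -> maps_to_line f y4 d e.
  move=> /(spans_ideal_aut autf)/diag_spans_ideal[u u0 fe] eE; exists u => //.
  have : lie (f e) (f e4) = d *: f e by rewrite -autf.2 eE linearZ.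
  rewrite yE; case: fe => ->.
  - rewrite !(vecZE1 e1 e2 e3 e4) (lie_vec fr_e) !vecZ => /(vec_inj fr_e.1)[E _ _ _].
    by apply: Or31; split=> //; apply: (mulIf u0); ring: E.
  - rewrite !(vecZE2 e1 e2 e3 e4) (lie_vec fr_e) !vecZ => /(vec_inj fr_e.1)[_ E _ _].
    by apply: Or32; split=> //; apply: (mulIf u0); ring: E.
  - rewrite !(vecZE3 e1 e2 e3 e4) (lie_vec fr_e) !vecZ => /(vec_inj fr_e.1)[_ _ E _].
    by apply: Or33; split=> //; apply: (mulIf u0); ring: E.
have [I1 I2 I3] := diag_spans_ideal_e; have [L1 L2 L3] := lie_e_e4.
by exists y4; split; apply: line.
Qed.

End Diagonal.

(** * Counting classes for a diagonal action *)

Section DiagonalClasses.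
Variables (R : realFieldType) (g : lieAlgType R) (d1 d2 d3 : R) (e1 e2 e3 e4 : g).
Hypothesis fr_e : is_frame d1 d2 d3 0 0 e1 e2 e3 e4.
Hypotheses (n12 : d1 <> d2) (n13 : d1 <> d3) (n23 : d2 <> d3).
Local Notation vec := (comb4 e1 e2 e3 e4).

Lemma maps_to_line_mem f c d e (V : {vspace g}) :
  maps_to_line d1 d2 d3 e1 e2 e3 f c d e -> e \in V ->
  [\/ e1 \in (f @: V)%VS /\ d = c * d1, e2 \in (f @: V)%VS /\ d = c * d2
    | e3 \in (f @: V)%VS /\ d = c * d3].
Proof.
case=> u u0 fe /(memv_img f); case: fe => -[-> dE];
  rewrite rpredZeq (negPf u0) /= => eV.
- by apply: Or31.
- by apply: Or32.
- by apply: Or33.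
Qed.

(** If [phi] takes the same nonzero value on two eigenvectors, their difference and [e4] lie in the
    kernel, while [phi] of their bracket is that value times the difference of the two
    eigenvalues. *)
Lemma diag_generating (phi : 'Hom(g, R^o)) :
  phi e4 = 0 -> phi e1 = phi e2 /\ phi e1 <> 0 \/
    phi e1 = phi e3 /\ phi e1 <> 0 \/ phi e2 = phi e3 /\ phi e2 <> 0 ->
  generating3 (lker phi).
Proof.
have gen (x1 x2 x3 : R) : phi e4 = 0 -> phi (vec x1 x2 x3 0) = 0 ->
    d1 * x1 * phi e1 + d2 * x2 * phi e2 + d3 * x3 * phi e3 != 0 :> R ->
    generating3 (lker phi).
  move=> p4 px /eqP pl; apply: (generating3_lker fr_e px p4).
  rewrite [X in lie _ X](vecE4 e1 e2 e3 e4) (lie_vec fr_e).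
  rewrite (form_vec e1 e2 e3 e4) => E; apply: pl.
  by rewrite -[RHS]E; ring.
move=> p4 [|[]] -[pE /eqP p0].
- apply: (gen 1 (-1) 0) => //; first by rewrite form_vec pE; ring.
  rewrite -pE !mulr0 mul0r addr0 mulr1 mulrN1 mulNr -mulrBl mulf_neq0 // subr_eq0.
  exact/eqP.
- apply: (gen 1 0 (-1)) => //; first by rewrite form_vec pE; ring.
  rewrite -pE !mulr0 mul0r addr0 mulr1 mulrN1 mulNr -mulrBl mulf_neq0 // subr_eq0.
  exact/eqP.
- apply: (gen 0 1 (-1)) => //; first by rewrite form_vec pE; ring.
  rewrite -pE !mulr0 mul0r add0r mulr1 mulrN1 mulNr -mulrBl mulf_neq0 // subr_eq0.
  exact/eqP.
Qed.

(* The orbit of a form is determined by the support of its restriction to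
   [e1], [e2], [e3]; singletons and the empty set give subalgebras. *)
Lemma diag_cover (V : {vspace g}) (f011 f101 f110 f111 : 'Hom(g, R^o)) :
  [/\ f011 e1 = 0, f011 e2 = 1, f011 e3 = 1 & f011 e4 = 0] ->
  [/\ f101 e1 = 1, f101 e2 = 0, f101 e3 = 1 & f101 e4 = 0] ->
  [/\ f110 e1 = 1, f110 e2 = 1, f110 e3 = 0 & f110 e4 = 0] ->
  [/\ f111 e1 = 1, f111 e2 = 1, f111 e3 = 1 & f111 e4 = 0] ->
  generating3 V ->
  exists2 U, U \in [:: lker f011; lker f101; lker f110; lker f111] &
    equivalent V U.
Proof.
move=> [a1 a2 a3 a4] [b1 b2 b3 b4] [c1 c2 c3 c4] [m1 m2 m3 m4].
move=> /(generating3_form fr_e)[phi -> nsub].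
have sub := eigenform_subalgebra fr_e (phi := phi).
have eqv := diag_equivalent fr_e (phi := phi).
have [p1|p1] := eqVneq (phi e1) 0; have [p2|p2] := eqVneq (phi e2) 0;
  have [p3|p3] := eqVneq (phi e3) 0.
- by case: nsub; apply: (sub 0); rewrite ?p1 ?p2 ?p3 ?(mulr0, subr0).
- by case: nsub; apply: (sub d3); rewrite ?p1 ?p2 ?(mulr0, subr0).
- by case: nsub; apply: (sub d2); rewrite ?p1 ?p3 ?(mulr0, mul0r, subr0).
- exists (lker f011); first by rewrite !inE eqxx.
  by apply: eqv; rewrite ?p1 ?eqxx ?p2 ?p3.
- by case: nsub; apply: (sub d1); rewrite ?p2 ?p3 ?(mulr0, mul0r, subr0).
- exists (lker f101); first by rewrite !inE eqxx orbT.
  by apply: eqv; rewrite ?p2 ?eqxx ?p1 ?p3.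
- exists (lker f110); first by rewrite !inE eqxx !orbT.
  by apply: eqv; rewrite ?p3 ?eqxx ?p1 ?p2.
- exists (lker f111); first by rewrite !inE eqxx !orbT.
  by apply: eqv; rewrite ?p1 ?p2 ?p3.
Qed.

Lemma diag_four_classes :
  (d1 = - d2 -> d3 <> 0) -> (d1 = - d3 -> d2 <> 0) -> (d2 = - d3 -> d1 <> 0) ->
  number_of_classes_is g 4.
Proof.
move=> s12 s13 s23.
(* Here [c = 1] and the weights are distinct, so each eigenline is preserved. *)
have sep (U V : {vspace g}) : equivalent U V ->
    [/\ e1 \in U -> e1 \in V, e2 \in U -> e2 \in V & e3 \in U -> e3 \in V].
  case=> f autf ->; have [c [L1 L2 L3]] := diag_aut fr_e n12 n13 n23 autf.
  have spec d e : maps_to_line d1 d2 d3 e1 e2 e3 f c d e ->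
      [\/ d = c * d1, d = c * d2 | d = c * d3].
    by case=> u _ [] [_ ?]; [apply: Or31 | apply: Or32 | apply: Or33].
  have c1 := scale_permutes_spectrum n12 n13 n23 s12 s13 s23
    (spec _ _ L1) (spec _ _ L2) (spec _ _ L3).
  by split=> eU;
    [have := maps_to_line_mem L1 eU | have := maps_to_line_mem L2 eU
    | have := maps_to_line_mem L3 eU]; rewrite c1 !mul1r; case=> -[] // _ dd;
    [case: n12 | case: n13 | case: n23].
have [fa [a1 a2 a3 a4]] := basis_hom fr_e.1 (0 : R^o) 1 1 0.
have [fb [b1 b2 b3 b4]] := basis_hom fr_e.1 (1 : R^o) 0 1 0.
have [fc [c1 c2 c3 c4]] := basis_hom fr_e.1 (1 : R^o) 1 0 0.
have [fm [m1 m2 m3 m4]] := basis_hom fr_e.1 (1 : R^o) 1 1 0.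
have one0 : (1 : R) <> 0 by apply/eqP/oner_neq0.
(* Each kernel but the last contains an eigenvector that no later kernel contains. *)
apply: (number_of_classes_reps (s := [:: lker fa; lker fb; lker fc; lker fm])).
- move=> V; rewrite !inE => /or4P[] /eqP ->; apply: diag_generating => //.
  + by right; right; rewrite a2 a3.
  + by right; left; rewrite b1 b3.
  + by left; rewrite c1 c2.
  + by left; rewrite m1 m2.
- move=> [|[|[|[|i]]]] [|[|[|[|j]]]] // _ _ /sep[];
    rewrite !memv_ker ?a1 ?a2 ?a3 ?b1 ?b2 ?b3 ?c1 ?c2 ?c3 ?m1 ?m2 ?m3;
    rewrite ?eqxx ?oner_eq0 => h1 h2 h3;
    by [have := h1 isT | have := h2 isT | have := h3 isT].
- by move=> V; apply: diag_cover.
Qed.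

Lemma diag_three_classes : d1 = - d2 -> d3 = 0 -> number_of_classes_is g 3.
Proof.
move=> d12 d30; have d2n : d2 <> 0 by move=> d20; case: n12; rewrite d12 d20 oppr0.
have d1n : d1 <> 0 by move=> d10; case: n13; rewrite d10 d30.
(* The lines of [e1] and [e2] may now be exchanged; what survives is containing some eigenline, and
   containing the line of weight 0. *)
have sep (U V : {vspace g}) : equivalent U V ->
    [/\ [|| e1 \in U, e2 \in U | e3 \in U] -> [|| e1 \in V, e2 \in V | e3 \in V] &
        e3 \in U -> e3 \in V].
  case=> f autf ->; have [c [L1 L2 L3]] := diag_aut fr_e n12 n13 n23 autf.
  split.
    by case/or3P=> eU; [have := maps_to_line_mem L1 eU
      | have := maps_to_line_mem L2 eU | have := maps_to_line_mem L3 eU];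
      case=> -[-> _]; rewrite ?orbT.
  have c0 : c <> 0.
    by move=> c0; case: L1 => u _; rewrite c0 !mul0r => -[] [_ /d1n].
  move=> /(maps_to_line_mem L3); rewrite d30; case=> -[] // _ /esym/eqP;
  rewrite mulf_eq0 => /orP[] /eqP //.
have [fa [a1 a2 a3 a4]] := basis_hom fr_e.1 (0 : R^o) 1 1 0.
have [fb [b1 b2 b3 b4]] := basis_hom fr_e.1 (1 : R^o) 0 1 0.
have [fc [c1 c2 c3 c4]] := basis_hom fr_e.1 (1 : R^o) 1 0 0.
have [fm [m1 m2 m3 m4]] := basis_hom fr_e.1 (1 : R^o) 1 1 0.
have one0 : (1 : R) <> 0 by apply/eqP/oner_neq0.
(* Replacing [e4] by its opposite exchanges the weights [d1] and [d2 = - d1] and keeps [d3 = 0]. *)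
have swap : is_frame d1 d2 d3 0 0 (vec 0 1 0 0) (vec 1 0 0 0) (vec 0 0 1 0)
    (vec 0 0 0 (-1)).
  apply: (is_frame_vec fr_e) => [k1 k2 k3 k4|].
    rewrite !(mulr0, addr0, add0r, mulr1, mulrN1) => -> -> -> /eqP.
    by rewrite oppr_eq0 => /eqP.
  rewrite !(lie_vec fr_e) !vecZ !(vecD fr_e.1) -(vec0 e1 e2 e3 e4) d12 d30.
  by split; [| | | |split]; congr comb4; ring.
have eab : equivalent (lker fa) (lker fb).
  by apply: (frame_equivalent fr_e swap);
    rewrite form_vec ?a1 ?a2 ?a3 ?a4 b1 b2 b3 b4; ring.
apply: (number_of_classes_reps (s := [:: lker fc; lker fb; lker fm])).
- move=> V; rewrite !inE => /or3P[] /eqP ->; apply: diag_generating => //.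
  + by left; rewrite c1 c2.
  + by right; left; rewrite b1 b3.
  + by left; rewrite m1 m2.
- move=> [|[|[|i]]] [|[|[|j]]] // _ _ /sep[];
    rewrite !memv_ker ?a1 ?a2 ?a3 ?b1 ?b2 ?b3 ?c1 ?c2 ?c3 ?m1 ?m2 ?m3;
    rewrite ?eqxx ?oner_eq0 ?orbT => h1 h2;
    by [have := h1 isT | have := h2 isT].
- move=> V gV; have [//|//|//|//|U] := diag_cover
    (f011 := fa) (f101 := fb) (f110 := fc) (f111 := fm) _ _ _ _ gV.
  rewrite !inE => /or4P[] /eqP -> eU.
  + exists (lker fb); first by rewrite !inE eqxx orbT.
    exact: equivalent_trans eU eab.
  + by exists (lker fb); rewrite // !inE eqxx orbT.
  + by exists (lker fc); rewrite // !inE eqxx.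
  + by exists (lker fm); rewrite // !inE eqxx !orbT.
Qed.

End DiagonalClasses.

Lemma diag_one_class (R : realFieldType) (g : lieAlgType R) (d d' : R)
    (e1 e2 e3 e4 : g) :
  is_frame d d' d' 0 0 e1 e2 e3 e4 -> d <> d' -> number_of_classes_is g 1.
Proof.
move=> fr_e ndd'.
have [fc [c1 c2 c3 c4]] := basis_hom fr_e.1 (1 : R^o) 1 0 0.
apply: (number_of_classes_reps (s := [:: lker fc])).
- move=> V; rewrite !inE => /eqP ->.
  have px : fc (comb4 e1 e2 e3 e4 1 (-1) 0 0) = 0 by rewrite form_vec c1 c2; ring.
  apply: (generating3_lker fr_e px c4).
  rewrite [X in lie _ X](vecE4 e1 e2 e3 e4) (lie_vec fr_e) form_vec c1 c2 c3 c4.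
  by move=> E; apply: ndd'; apply/eqP; rewrite -subr_eq0 -[eqbRHS]E; apply/eqP; ring.
- by move=> [|i] [|j].
- move=> V /(generating3_form fr_e)[phi -> nsub].
  exists (lker fc); first by rewrite !inE eqxx.
  have sub := eigenform_subalgebra fr_e (phi := phi).
  have [p1|p1] := eqVneq (phi e1) 0.
    by case: nsub; apply: (sub d'); rewrite ?p1 ?(mulr0, mul0r, subr0).
  have [p23|p23] := eqVneq (phi e2 ^+ 2 + phi e3 ^+ 2 : R) 0.
    move: p23 => /eqP; rewrite paddr_eq0 ?sqr_ge0 // !sqrf_eq0.
    case/andP=> /eqP p2 /eqP p3.
    by case: nsub; apply: (sub d); rewrite ?p2 ?p3 ?(mulr0, mul0r, subr0).
  pose vec := comb4 e1 e2 e3 e4.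
  (* Any invertible map of the eigenplane is allowed; this one is a similarity of determinant
     [phi e2 ^+ 2 + phi e3 ^+ 2], chosen so that [fc] takes the values [phi e2] and [phi e3] on the
     new vectors. *)
  have fr_v : is_frame d d' d' 0 0 (vec (phi e1) 0 0 0) (vec 0 (phi e2) (- phi e3) 0)
      (vec 0 (phi e3) (phi e2) 0) (vec (phi e4) 0 0 1).
    apply: (is_frame_vec fr_e) => [k1 k2 k3 k4|].
      rewrite !mulr0 !addr0 !add0r mulr1 => + + + k40; rewrite k40 !mul0r !addr0.
      move=> /eqP; rewrite mulf_eq0 (negPf p1) orbF => /eqP -> E2 E3.
      have : k2 * (phi e2 ^+ 2 + phi e3 ^+ 2) = phi e2 * (k2 * phi e2 + k3 * phi e3)
        - phi e3 * (k2 * - phi e3 + k3 * phi e2) :> R by ring.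
      rewrite E2 E3 !mulr0 subr0 => /eqP; rewrite mulf_eq0 (negPf p23) orbF => /eqP ->.
      have : k3 * (phi e2 ^+ 2 + phi e3 ^+ 2) = phi e3 * (k2 * phi e2 + k3 * phi e3)
        + phi e2 * (k2 * - phi e3 + k3 * phi e2) :> R by ring.
      rewrite E2 E3 !mulr0 addr0 => /eqP.
      by rewrite mulf_eq0 (negPf p23) orbF => /eqP ->.
    rewrite !(lie_vec fr_e) !vecZ !(vecD fr_e.1) -(vec0 e1 e2 e3 e4).
    by split; [| | | |split]; congr comb4; ring.
  by apply: (frame_equivalent fr_e fr_v); rewrite form_vec c1 c2 c3 c4; ring.
Qed.

(** * A Jordan block of eigenvalue 1 together with an eigenvalue [p] *)

Section Jordan.
Variables (R : realFieldType) (g : lieAlgType R) (p : R) (e1 e2 e3 e4 : g).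
Hypothesis fr_e : is_frame p 1 1 1 0 e1 e2 e3 e4.
Local Notation vec := (comb4 e1 e2 e3 e4).

(** The Jordan block commutes with the matrices built from [u] and [w]. The image of [e1] may
    acquire a multiple of [e2] only if both have the same weight, which is the condition on [m]. *)
Lemma jordan_frame a m u w t1 t2 : a != 0 -> u != 0 -> p * m = m ->
  is_frame p 1 1 1 0 (vec a m 0 0) (vec 0 u 0 0) (vec 0 w u 0) (vec t1 t2 0 1).
Proof.
move=> a0 u0 pm; apply: (is_frame_vec fr_e) => [k1 k2 k3 k4|].
  rewrite !mulr0 !addr0 !add0r mulr1 => + + + k40; rewrite k40 !mul0r !addr0.
  move=> /eqP; rewrite mulf_eq0 (negPf a0) orbF => /eqP -> E2 /eqP.
  rewrite mulf_eq0 (negPf u0) orbF => /eqP k30; move: E2; rewrite k30.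
  by rewrite !mul0r add0r addr0 => /eqP; rewrite mulf_eq0 (negPf u0) orbF => /eqP ->.
rewrite !(lie_vec fr_e) !vecZ !(vecD fr_e.1) -(vec0 e1 e2 e3 e4) pm.
by split; [| | | |split]; congr comb4; ring.
Qed.

Lemma jordan_generating (phi : 'Hom(g, R^o)) : phi e4 = 0 ->
  phi e2 <> 0 /\ phi e3 = 0 \/
    [/\ phi e1 = phi e3, phi e2 = 0, phi e1 <> 0 & p <> 1] ->
  generating3 (lker phi).
Proof.
move=> p4 [[p2 p3]|[p13 p2 /eqP p1 np1]].
  apply: (generating3_lker fr_e p3 p4).
  by case: fr_e => _ [_ _ -> _ _]; rewrite formD !formZ p3 mulr0 addr0 mul1r.
have px : phi (vec 1 0 (-1) 0) = 0 by rewrite form_vec p13 p2; ring.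
apply: (generating3_lker fr_e px p4).
rewrite [X in lie _ X](vecE4 e1 e2 e3 e4) (lie_vec fr_e) form_vec p2 -p13 => E.
have /eqP : (p - 1) * phi e1 = 0 :> R by rewrite -[RHS]E; ring.
by rewrite mulf_eq0 (negPf p1) orbF subr_eq0 => /eqP.
Qed.

Lemma jordan_one_class : p = 1 -> number_of_classes_is g 1.
Proof.
move=> p1.
have [fa [a1 a2 a3 a4]] := basis_hom fr_e.1 (0 : R^o) 1 0 0.
apply: (number_of_classes_reps (s := [:: lker fa])).
- move=> V; rewrite !inE => /eqP ->; apply: jordan_generating => //.
  by left; rewrite a2 a3; split=> //; apply/eqP/oner_neq0.
- by move=> [|i] [|j].
- move=> V /(generating3_form fr_e)[phi -> nsub].
  exists (lker fa); first by rewrite !inE eqxx.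
  have [p2|p2] := eqVneq (phi e2) 0.
    case: nsub; apply: (eigenform_subalgebra fr_e (l := 1));
      by rewrite ?p1 ?p2 ?mulr0 ?subr0.
  (* The shear with [m = phi e1], available since [p = 1], accounts for the value of [phi] on
     [e1]. *)
  have pm : p * phi e1 = phi e1 by rewrite p1 mul1r.
  apply: (frame_equivalent fr_e
    (jordan_frame (phi e3) 0 (phi e4) (oner_neq0 R) p2 pm));
  by rewrite form_vec a1 a2 a3 a4; ring.
Qed.

Hypothesis p_neq1 : p <> 1.

Lemma jordan_spans_ideal_e : spans_ideal e1 /\ spans_ideal e2.
Proof.
split; split.
- rewrite (vecE1 e1 e2 e3 e4) -(vec0 e1 e2 e3 e4).
  by apply/eqP => /(vec_inj fr_e.1)[/eqP]; rewrite oner_eq0.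
- move=> y; have [y1 [y2 [y3 [y4 ->]]]] := vecP fr_e.1 y; exists (y4 * p).
  rewrite [X in lie X](vecE1 e1 e2 e3 e4) (lie_vec fr_e) (vecZE1 e1 e2 e3 e4).
  by congr comb4; ring.
- rewrite (vecE2 e1 e2 e3 e4) -(vec0 e1 e2 e3 e4).
  by apply/eqP => /(vec_inj fr_e.1)[_ /eqP]; rewrite oner_eq0.
- move=> y; have [y1 [y2 [y3 [y4 ->]]]] := vecP fr_e.1 y; exists y4.
  rewrite [X in lie X](vecE2 e1 e2 e3 e4) (lie_vec fr_e) (vecZE2 e1 e2 e3 e4).
  by congr comb4; ring.
Qed.

Lemma jordan_spans_ideal x : spans_ideal x ->
  exists2 u : R, u != 0 & x = u *: e1 \/ x = u *: e2.
Proof.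
have [x1 [x2 [x3 [x4 ->]]]] := vecP fr_e.1 x; case=> x0 xI.
have x40 : x4 = 0.
  have [k] := xI (vec 0 1 0 0); rewrite (lie_vec fr_e) vecZ.
  move=> /(vec_inj fr_e.1)[_ E _ /esym/eqP]; rewrite mulf_eq0 => /orP[] /eqP // k0.
  by move: E; rewrite k0; lra.
have [k] := xI (vec 0 0 0 1).
rewrite (lie_vec fr_e) vecZ x40 !(mulr0, mul0r, mulr1, addr0, subr0, mul1r).
move=> /(vec_inj fr_e.1)[E1 E2 E3 _].
have eigen (d y : R) : d * y = k * y -> y != 0 -> d = k.
  by move=> dy y0; apply: (mulIf y0).
have x30 : x3 = 0.
  have [//|x3n] := eqVneq x3 0.
  by move: E2; rewrite -(eigen 1 x3) ?mul1r //; lra.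
move: E2; rewrite x30 addr0 -{1}[x2]mul1r => E2.
move: x0; rewrite x40 x30.
have [x10|x1n] := eqVneq x1 0; have [x20|x2n] := eqVneq x2 0.
- by rewrite x10 x20 vec0 eqxx.
- by exists x2 => //; right; rewrite x10 (vecZE2 e1 e2 e3 e4).
- by exists x1 => //; left; rewrite x20 (vecZE1 e1 e2 e3 e4).
- by case: p_neq1; rewrite (eigen _ _ E1) ?(eigen _ _ E2).
Qed.

(* If [f] exchanged the lines of [e1] and [e2], then [p = -1], and applying [f] to
   [lie e3 e4 = e2 + e3] would force [f e2 = 0]. *)
Lemma jordan_aut_e1 f : lie_automorphism f ->
  exists2 u : R, u != 0 & f e1 = u *: e1.
Proof.
move=> autf; have [I1 I2] := jordan_spans_ideal_e.
have [u u0 [->|f1]] := jordan_spans_ideal (spans_ideal_aut autf I1); first by exists u.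
have [y1 [y2 [y3 [y4 yE]]]] := vecP fr_e.1 (f e4).
have [z1 [z2 [z3 [z4 zE]]]] := vecP fr_e.1 (f e3).
case: (fr_e) => _ [l14 l24 l34 _ _].
have yp : y4 = p.
  have := congr1 f l14; rewrite autf.2 linearZ /= f1 yE.
  rewrite !(vecZE2 e1 e2 e3 e4) (lie_vec fr_e) vecZ.
  move=> /(vec_inj fr_e.1)[_ E _ _]; apply: (mulIf u0).
  by rewrite -E; ring.
have [w w0 [f2|f2]] := jordan_spans_ideal (spans_ideal_aut autf I2); last first.
  have := congr1 f l24; rewrite autf.2 linearZ /= f2 yE.
  rewrite !(vecZE2 e1 e2 e3 e4) (lie_vec fr_e) vecZ.
  move=> /(vec_inj fr_e.1)[_ E _ _]; case: p_neq1; rewrite -yp; apply: (mulIf w0).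
  by rewrite -E; ring.
have pp : p * p = 1.
  have := congr1 f l24; rewrite autf.2 linearZ /= f2 yE.
  rewrite !(vecZE1 e1 e2 e3 e4) (lie_vec fr_e) vecZ.
  move=> /(vec_inj fr_e.1)[E _ _ _]; apply: (mulIf w0).
  by rewrite -E yp; ring.
(* The coordinates of [f e3] vanish in the order e4, e3, e2, by [p <> 1]; the e1-coordinate with
   [p * p = 1] then leaves [w = 0]. *)
have := congr1 f l34; rewrite autf.2 linearD !linearZ /= f2 zE yE (vecZE1 e1 e2 e3 e4).
rewrite (lie_vec fr_e) !vecZ (vecD fr_e.1) yp.
move=> /(vec_inj fr_e.1)[E1 E2 E3 E4].
have z40 : z4 = 0 by move: E4; lra.
have eq0 (z : R) : z * p = z -> z = 0.
  move=> zp; have /eqP : (p - 1) * z = 0 by rewrite mulrBl mulrC zp mul1r subrr.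
  rewrite mulf_eq0 => /orP[|/eqP //]; rewrite subr_eq0 => /eqP //.
have z30 : z3 = 0 by apply: eq0; move: E3; rewrite z40 => E3; lra.
have z20 : z2 = 0 by apply: eq0; move: E2; rewrite z40 z30 => E2; lra.
case/eqP: w0; move: E1; rewrite z40 z30 z20.
have : p * p * z1 = z1 by rewrite pp mul1r.
by move=> pz1 E1; lra.
Qed.

Lemma jordan_three_classes : number_of_classes_is g 3.
Proof.
have [I1 I2] := jordan_spans_ideal_e.
(* The three kernels below contain, respectively, only the ideal line of [e1], only that of [e2],
   and neither; this one-directional invariant separates them in that order. *)
have sep (U V : {vspace g}) : equivalent U V ->
    (e1 \in U -> e1 \in V) /\ (e2 \in U -> (e1 \in V) || (e2 \in V)).
  case=> f autf ->; split=> /(memv_img f).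
    by have [u u0 ->] := jordan_aut_e1 autf; rewrite rpredZeq (negPf u0).
  by have [u u0 [->|->]] := jordan_spans_ideal (spans_ideal_aut autf I2);
    rewrite rpredZeq (negPf u0) /= => ->; rewrite ?orbT.
have [fa [a1 a2 a3 a4]] := basis_hom fr_e.1 (0 : R^o) 1 0 0.
have [fb [b1 b2 b3 b4]] := basis_hom fr_e.1 (1 : R^o) 0 1 0.
have [fc [c1 c2 c3 c4]] := basis_hom fr_e.1 (1 : R^o) 1 0 0.
have one0 : (1 : R) <> 0 by apply/eqP/oner_neq0.
have p0 : p * 0 = 0 by rewrite mulr0.
apply: (number_of_classes_reps (s := [:: lker fa; lker fb; lker fc])).
- move=> V; rewrite !inE => /or3P[] /eqP ->; apply: jordan_generating => //.
  + by left; rewrite a2 a3.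
  + by right; rewrite b1 b2 b3.
  + by left; rewrite c2 c3.
- move=> [|[|[|i]]] [|[|[|j]]] // _ _ /sep[];
    rewrite !memv_ker ?a1 ?a2 ?b1 ?b2 ?c1 ?c2 ?eqxx ?oner_eq0 => h1 h2;
    by [have := h1 isT | have := h2 isT].
- move=> V /(generating3_form fr_e)[phi -> nsub].
  have sub := eigenform_subalgebra fr_e (phi := phi).
  have [p2|p2] := eqVneq (phi e2) 0; last first.
    have [p1|p1] := eqVneq (phi e1) 0.
      exists (lker fa); first by rewrite !inE eqxx.
      apply: (frame_equivalent fr_e
        (jordan_frame (phi e3) 0 (phi e4) (oner_neq0 R) p2 p0));
      by rewrite form_vec a1 a2 a3 a4 ?p1; ring.
    exists (lker fc); first by rewrite !inE eqxx !orbT.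
    apply: (frame_equivalent fr_e (jordan_frame (phi e3) 0 (phi e4) p1 p2 p0));
    by rewrite form_vec c1 c2 c3 c4; ring.
  have [p1|p1] := eqVneq (phi e1) 0.
    by case: nsub; apply: (sub 1); rewrite ?p1 ?p2 ?(mulr0, subr0).
  have [p3|p3] := eqVneq (phi e3) 0.
    by case: nsub; apply: (sub p); rewrite ?p2 ?p3 ?(mulr0, subr0).
  exists (lker fb); first by rewrite !inE eqxx orbT.
  apply: (frame_equivalent fr_e (jordan_frame 0 (phi e4) 0 p1 p3 p0));
  by rewrite form_vec b1 b2 b3 b4 ?p2; ring.
Qed.

End Jordan.

(** * The Heisenberg case *)

Section Heisenberg.
Variables (R : realFieldType) (g : lieAlgType R) (alpha : R) (e1 e2 e3 e4 : g).
Hypothesis fr_e : is_frame (1 + alpha) 1 alpha 0 1 e1 e2 e3 e4.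
Local Notation vec := (comb4 e1 e2 e3 e4).

Lemma heisenberg_generating (phi : 'Hom(g, R^o)) : phi e4 = 0 ->
  [/\ phi e1 <> 0, phi e2 = 0 & phi e3 = 0] \/
  [/\ phi e1 = 0, phi e2 = phi e3, phi e2 <> 0 & alpha <> 1] ->
  generating3 (lker phi).
Proof.
move=> p4 [[p1 p2 p3]|[p1 p23 /eqP p2 na1]].
  apply: (generating3_lker fr_e p2 p3).
  by case: fr_e => _ [_ _ _ -> _]; rewrite scale1r.
have px : phi (vec 0 1 (-1) 0) = 0 by rewrite form_vec p1 p23; ring.
apply: (generating3_lker fr_e px p4).
rewrite [X in lie _ X](vecE4 e1 e2 e3 e4) (lie_vec fr_e) form_vec p1 -p23 => E.
have /eqP : (alpha - 1) * phi e2 = 0 :> R by rewrite -[RHS]oppr0 -[in RHS]E; ring.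
by rewrite mulf_eq0 (negPf p2) orbF subr_eq0 => /eqP.
Qed.

(** The form factors through the quotient by [e1], which is almost abelian with weights 1 and
    [alpha]; the second hypothesis makes it an eigenform there, with eigenvalue [l]. *)
Lemma heisenberg_subalgebra (phi : 'Hom(g, R^o)) :
  phi e1 = 0 -> (alpha - 1) * phi e2 * phi e3 = 0 ->
  forall x y, phi x = 0 -> phi y = 0 -> phi (lie x y) = 0.
Proof.
move=> p1 p23 x y.
have [x1 [x2 [x3 [x4 ->]]]] := vecP fr_e.1 x.
have [y1 [y2 [y3 [y4 ->]]]] := vecP fr_e.1 y.
rewrite (lie_vec fr_e) !form_vec p1 => X Y.
have [l l2 l3] : exists2 l : R, phi e2 = l * phi e2 & alpha * phi e3 = l * phi e3.
  move: p23 => /eqP; rewrite !mulf_eq0 subr_eq0 => /orP[/orP[]|] /eqP ->.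
  - by exists 1; rewrite ?mul1r.
  - by exists alpha; rewrite ?mulr0.
  - by exists 1; rewrite ?mul1r ?mulr0.
transitivity (l * (y4 * (x1 * 0 + x2 * phi e2 + x3 * phi e3 + x4 * phi e4)
  - x4 * (y1 * 0 + y2 * phi e2 + y3 * phi e3 + y4 * phi e4)) : R).
  transitivity ((x2 * y4 - x4 * y2) * phi e2 +
    (x3 * y4 - x4 * y3) * (alpha * phi e3) : R).
    by ring.
  by rewrite l3 [X in _ * X + _]l2; ring.
by rewrite X Y !mulr0 subr0 mulr0.
Qed.

Lemma heisenberg_equivalent_e1 (phi psi : 'Hom(g, R^o)) :
  psi e1 = 1 -> psi e2 = 0 -> psi e3 = 0 -> psi e4 = 0 -> phi e1 <> 0 ->
  equivalent (lker phi) (lker psi).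
Proof.
move=> E1 E2 E3 E4 /eqP a1.
(* Adding multiples of [e1] to [e2] and [e3] realises the values [phi e2] and [phi e3]; the [e2] and
   [e3] coefficients of the fourth vector are forced by its brackets with the second and third. *)
have fr_v : is_frame (1 + alpha) 1 alpha 0 1 (vec (phi e1) 0 0 0)
    (vec (phi e2) 1 0 0) (vec (phi e3) 0 (phi e1) 0)
    (vec (phi e4) (phi e3 / phi e1) (- (alpha * phi e2)) 1).
  apply: (is_frame_vec fr_e) => [k1 k2 k3 k4|].
    rewrite !mulr0 !addr0 !add0r !mulr1 => + + + k40; rewrite k40 !mul0r !addr0.
    move=> + k20; rewrite k20 mul0r addr0 => + /eqP.
    rewrite mulf_eq0 (negPf a1) orbF => + /eqP k30; rewrite k30 mul0r addr0 => /eqP.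
    by rewrite mulf_eq0 (negPf a1) orbF => /eqP ->.
  rewrite !(lie_vec fr_e) !vecZ !(vecD fr_e.1) -(vec0 e1 e2 e3 e4).
  by split; [| | | |split]; congr comb4; field.
by apply: (frame_equivalent fr_e fr_v); rewrite form_vec E1 E2 E3 E4; ring.
Qed.

Lemma heisenberg_equivalent_e23 (phi psi : 'Hom(g, R^o)) :
  psi e1 = 0 -> psi e2 = 1 -> psi e3 = 1 -> psi e4 = 0 ->
  phi e1 = 0 -> phi e2 <> 0 -> phi e3 <> 0 -> equivalent (lker phi) (lker psi).
Proof.
move=> E1 E2 E3 E4 a1 /eqP a2 /eqP a3.
(* Translating [e4] by [phi e4] times [e2] perturbs its bracket with [e3] by a multiple of [e1],
   compensated by the [e1] term of the third vector. *)
have fr_v : is_frame (1 + alpha) 1 alpha 0 1 (vec (phi e2 * phi e3) 0 0 0)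
    (vec 0 (phi e2) 0 0) (vec (phi e3 * phi e4) 0 (phi e3) 0)
    (vec 0 (phi e4) 0 1).
  apply: (is_frame_vec fr_e) => [k1 k2 k3 k4|].
    rewrite !mulr0 !addr0 !add0r !mulr1 => + + + k40; rewrite k40 !mul0r !addr0.
    move=> + /eqP; rewrite mulf_eq0 (negPf a2) orbF => + /eqP k20 /eqP.
    rewrite mulf_eq0 (negPf a3) orbF => + /eqP k30; rewrite k30 mul0r addr0 => /eqP.
    by rewrite !mulf_eq0 (negPf a2) (negPf a3) !orbF => /eqP ->.
  rewrite !(lie_vec fr_e) !vecZ !(vecD fr_e.1) -(vec0 e1 e2 e3 e4).
  by split; [| | | |split]; congr comb4; ring.
by apply: (frame_equivalent fr_e fr_v); rewrite form_vec E1 E2 E3 E4 ?a1; ring.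
Qed.

Lemma heisenberg_one_class : alpha = 1 -> number_of_classes_is g 1.
Proof.
move=> al1; have one0 : (1 : R) <> 0 by apply/eqP/oner_neq0.
have [fa [a1 a2 a3 a4]] := basis_hom fr_e.1 (1 : R^o) 0 0 0.
apply: (number_of_classes_reps (s := [:: lker fa])).
- move=> V; rewrite !inE => /eqP ->; apply: heisenberg_generating => //.
  by left; rewrite a1.
- by move=> [|i] [|j].
- move=> V /(generating3_form fr_e)[phi -> nsub].
  exists (lker fa); first by rewrite !inE eqxx.
  apply: heisenberg_equivalent_e1 => // p1; case: nsub.
  by apply: heisenberg_subalgebra; rewrite // al1 subrr !mul0r.
Qed.

Lemma heisenberg_spans_ideal_e1 : spans_ideal e1.
Proof.
split.
  rewrite (vecE1 e1 e2 e3 e4) -(vec0 e1 e2 e3 e4).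
  by apply/eqP => /(vec_inj fr_e.1)[/eqP]; rewrite oner_eq0.
move=> y; have [y1 [y2 [y3 [y4 ->]]]] := vecP fr_e.1 y.
exists (y4 * (1 + alpha)).
rewrite [X in lie X](vecE1 e1 e2 e3 e4) (lie_vec fr_e) (vecZE1 e1 e2 e3 e4).
by congr comb4; ring.
Qed.

(** Brackets with [e2] and [e3] eliminate the coordinates along e4, e3 and e2 in turn, for every
    [alpha]. Hence every automorphism preserves the line of [e1]. *)
Lemma heisenberg_spans_ideal x : spans_ideal x ->
  exists2 u : R, u != 0 & x = u *: e1.
Proof.
have [x1 [x2 [x3 [x4 ->]]]] := vecP fr_e.1 x; case=> x0 xI.
have x40 : x4 = 0.
  have [k] := xI (vec 0 1 0 0); rewrite (lie_vec fr_e) vecZ.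
  move=> /(vec_inj fr_e.1)[_ E _ /esym/eqP]; rewrite mulf_eq0 => /orP[] /eqP // k0.
  by move: E; rewrite k0; lra.
have x30 : x3 = 0.
  have [k] := xI (vec 0 1 0 0); rewrite (lie_vec fr_e) vecZ x40.
  move=> /(vec_inj fr_e.1)[E _ + _]; rewrite !(mul0r, mulr0, subrr).
  move=> /esym/eqP; rewrite mulf_eq0 => /orP[] /eqP // k0.
  by move: E; rewrite k0; lra.
have x20 : x2 = 0.
  have [k] := xI (vec 0 0 1 0); rewrite (lie_vec fr_e) vecZ x40.
  move=> /(vec_inj fr_e.1)[E + _ _]; rewrite !(mul0r, mulr0, subrr, addr0).
  move=> /esym/eqP; rewrite mulf_eq0 => /orP[] /eqP // k0.
  by move: E; rewrite k0; lra.
move: x0; rewrite x20 x30 x40 => x0.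
exists x1; last by rewrite (vecZE1 e1 e2 e3 e4).
by apply: contraNneq x0 => ->; rewrite vec0.
Qed.

Lemma heisenberg_two_classes : alpha <> 1 -> number_of_classes_is g 2.
Proof.
move=> nal1; have one0 : (1 : R) <> 0 by apply/eqP/oner_neq0.
have [fa [a1 a2 a3 a4]] := basis_hom fr_e.1 (0 : R^o) 1 1 0.
have [fb [b1 b2 b3 b4]] := basis_hom fr_e.1 (1 : R^o) 0 0 0.
apply: (number_of_classes_reps (s := [:: lker fa; lker fb])).
- move=> V; rewrite !inE => /orP[] /eqP ->; apply: heisenberg_generating => //.
    by right; rewrite a1 a2 a3.
  by left; rewrite b1.
- move=> [|[|i]] [|[|j]] // _ _ [f autf /= fV].
  have [u u0 fe1] := heisenberg_spans_ideal
    (spans_ideal_aut autf heisenberg_spans_ideal_e1).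
  have : e1 \in lker fa by rewrite memv_ker a1.
  move=> /(memv_img f); rewrite fe1 rpredZeq (negPf u0) /= => e1V.
  have : e1 \in lker fb by rewrite fV.
  by rewrite memv_ker b1 oner_eq0.
- move=> V /(generating3_form fr_e)[phi -> nsub].
  have sub := heisenberg_subalgebra (phi := phi).
  have [p1|/eqP p1] := eqVneq (phi e1) 0; last first.
    exists (lker fb); first by rewrite !inE eqxx orbT.
    exact: heisenberg_equivalent_e1.
  exists (lker fa); first by rewrite !inE eqxx.
  by apply: heisenberg_equivalent_e23 => // pz; case: nsub; apply: sub;
    rewrite // pz ?(mulr0, mul0r).
Qed.

End Heisenberg.

(** * The four families as frames, and the conclusion *)

(** [E3] takes the place of [e4]: bracketing with it has eigenvectors [E1 + E2] and [E1 - E2], and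
    the central [E4] supplies the eigenvalue 0. *)
Lemma g34_g1_frame (R : realFieldType) (g : lieAlgType R) (alpha : R) :
  is_g34_g1 alpha g ->
  exists e1 e2 e3 e4 : g, is_frame (1 - alpha) (- (1 + alpha)) 0 0 0 e1 e2 e3 e4.
Proof.
case=> E1 [E2 [E3 [E4 [E_basis [l23 l31 l12 [l14 l24 l34]]]]]].
exists (E1 + E2), (E1 - E2), E4, E3; split.
  apply: basis4 (dim_frame E_basis) _ => k1 k2 k3 k4.
  have -> : comb4 (E1 + E2) (E1 - E2) E4 E3 k1 k2 k3 k4 =
      comb4 E1 E2 E3 E4 (k1 + k2) (k1 - k2) k4 k3.
    by apply: (eq_formP E_basis) => phi; rewrite !form_vec !(formD, formN); ring.
  rewrite -(vec0 E1 E2 E3 E4) => /(vec_inj E_basis)[k12 k12' -> ->].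
  by split; lra.
have l13 : lie E1 E3 = E2 - alpha *: E1 by rewrite lieC l31 opprB.
split; [| | | |split]; rewrite ?(lieDl, lieNl, lieDr, lieNr) ?liexx;
  rewrite ?[lie E2 E1]lieC ?l12 ?l13 ?l23 ?l14 ?l24 ?[lie E4 E3]lieC ?l34;
  apply: (eq_formP E_basis) => phi; rewrite !(formD, formN, formZ, form0); ring.
Qed.

Lemma g42_frame (R : realFieldType) (g : lieAlgType R) (alpha : R) :
  is_g42 alpha g ->
  exists e1 e2 e3 e4 : g, is_frame alpha 1 1 1 0 e1 e2 e3 e4.
Proof.
case=> E1 [E2 [E3 [E4 [E_basis [l14 l24 l34 [l12 l13 l23]]]]]].
by exists E1, E2, E3, E4; split=> //; rewrite !scale1r scale0r.
Qed.

(** Two orderings of the eigenvectors, so that a double eigenvalue, whether [alpha = beta] or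
    [beta = 1], can be put in the last two places, as [diag_one_class] expects. *)
Lemma g45_frame (R : realFieldType) (g : lieAlgType R) (alpha beta : R) :
  is_g45 alpha beta g ->
  exists e1 e2 e3 e4 : g, is_frame 1 beta alpha 0 0 e1 e2 e3 e4 /\
    is_frame alpha beta 1 0 0 e3 e2 e1 e4.
Proof.
case=> E1 [E2 [E3 [E4 [E_basis [l14 l24 l34 [l12 l13 l23]]]]]].
exists E1, E2, E3, E4; split; split=> //.
- by rewrite !scale1r !scale0r add0r.
- rewrite -(perm_basis _ (_ : perm_eq [:: E1; E2; E3; E4] _)) //.
  by apply/permP => P /=; rewrite [LHS]addnCA [RHS]addnCA; congr addn; apply: addnCA.
- rewrite !scale1r !scale0r add0r; split=> //; last split.
  + by rewrite lieC l12 oppr0.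
  + by rewrite lieC l23 oppr0.
  + by rewrite lieC l13 oppr0.
Qed.

Lemma g48_frame (R : realFieldType) (g : lieAlgType R) (alpha : R) :
  is_g48 alpha g ->
  exists e1 e2 e3 e4 : g, is_frame (1 + alpha) 1 alpha 0 1 e1 e2 e3 e4.
Proof.
case=> E1 [E2 [E3 [E4 [E_basis [l14 l24 l34 l23 [l12 l13]]]]]].
by exists E1, E2, E3, E4; split=> //; rewrite !scale1r scale0r add0r.
Qed.

Theorem corollary3 (R : realType) (g : lieAlgType R) :
  [/\ forall alpha : R, is_g34_g1 alpha g -> 0 <= alpha -> alpha <> 1 ->
        (alpha = 0 -> number_of_classes_is g 3) /\
        (alpha <> 0 -> number_of_classes_is g 4),
      forall alpha : R, is_g42 alpha g -> alpha <> 0 ->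
        (alpha = 1 -> number_of_classes_is g 1) /\
        (alpha <> 1 -> number_of_classes_is g 3),
      forall alpha beta : R, is_g45 alpha beta g ->
        (-1 < alpha /\ alpha <= beta /\ beta <= 1 /\ alpha * beta <> 0) \/
        (alpha = -1 /\ 0 < beta /\ beta <= 1) ->
        (alpha, beta) <> (1, 1) ->
        ((alpha = beta /\ beta <> 1) \/ (beta = 1 /\ alpha <> 1) ->
           number_of_classes_is g 1) /\
        (~ ((alpha = beta /\ beta <> 1) \/ (beta = 1 /\ alpha <> 1)) ->
           number_of_classes_is g 4)
    & forall alpha : R, is_g48 alpha g -> -1 <= alpha -> alpha <= 1 ->
        (alpha = 1 -> number_of_classes_is g 1) /\
        (alpha <> 1 -> number_of_classes_is g 2)].
Proof.
split.
- move=> alpha /g34_g1_frame[e1 [e2 [e3 [e4 fr_e]]]] al_ge0 al_neq1.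
  have n12 : 1 - alpha <> - (1 + alpha) by lra.
  have n13 : 1 - alpha <> 0 by lra.
  have n23 : - (1 + alpha) <> 0 by lra.
  split=> [al0|al_neq0].
    (* For [alpha = 0] the spectrum is {1, -1, 0}, the exceptional one. *)
    by apply: (diag_three_classes fr_e) => //; rewrite al0; lra.
  by apply: (diag_four_classes fr_e) => //; lra.
- move=> alpha /g42_frame[e1 [e2 [e3 [e4 fr_e]]]] al_neq0; split=> al1.
    exact: jordan_one_class fr_e al1.
  exact: jordan_three_classes fr_e al1.
- move=> alpha beta /g45_frame[e1 [e2 [e3 [e4 [fr_e fr_e']]]]] range ab_neq1.
  split.
    case=> [[eq_ab b_neq1]|[b1 a_neq1]].
      by move: fr_e; rewrite eq_ab => /diag_one_class; apply; apply/nesym.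
    by move: fr_e'; rewrite b1 => /diag_one_class; apply.
  move=> nondeg.
  have b_neq1 : beta <> 1.
    by move=> b1; apply: nondeg; right; split=> // a1; apply: ab_neq1; rewrite a1 b1.
  have a_neqb : alpha <> beta by move=> eq_ab; apply: nondeg; left.
  have [al_lt1 al_neq0 b_neq0] : [/\ alpha < 1, alpha <> 0 & beta <> 0].
    case: range => [[_ [le_ab [b_le1 /eqP]]]|[-> [b_gt0 _]]]; last by split; lra.
    rewrite mulf_eq0 negb_or => /andP[/eqP a0 /eqP b0]; split=> //.
    by rewrite lt_neqAle (le_trans le_ab b_le1) andbT; apply/eqP; lra.
  (* The eigenvalues 1, [beta], [alpha] are distinct and nonzero, so the exceptional spectrum cannot
     occur, even when [alpha = -1]. *)
  by apply: (diag_four_classes fr_e) => //; [exact/nesym | lra | exact/nesym | lra].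
- move=> alpha /g48_frame[e1 [e2 [e3 [e4 fr_e]]]] _ _; split.
    exact: heisenberg_one_class fr_e.
  exact: heisenberg_two_classes fr_e.
Qed.
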